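(* Let $a,b,c,d\in\mathbb{Z}$. For any $u\in\mathbb{Z}$ denote $\gamma_u=\frac{cu^4+bu^2+a}{du^3}$. Then $$\mathcal{GP}_{(a,b,c,d)}(\mathbb{Q})=\left\{\left(\pm\gamma_u,\,u\gamma_u,\,\pm u^2\gamma_u\right) : u^2\mid a,\ u>0,\ du^3\mid (cu^4+bu^2+a)\right\}.$$ Furthermore, if $a$ is squarefree and $\gamma=\frac{a+b+c}{d}$, then $$\mathcal{GP}_{(a,b,c,d)}(\mathbb{Q})=\begin{cases}\{(\pm\gamma,\gamma,\pm\gamma)\} & \text{if } d\mid (a+b+c),\\ \emptyset & \text{otherwise.}\end{cases}$$
   Context: $\mathcal{GP}_{(a,b,c,d)}(\mathbb{Q})$ denotes the set of non-trivial triples $(x,y,z)\in\mathbb{Z}^3$ in geometric progression satisfying $ax^2+by^2+cz^2=dxyz$. Here $(x,y,z)$ is in geometric progression over $\mathbb{Z}$ if there exist $\alpha,\beta\in\mathbb{Z}$ with $x=\alpha$, $y=\alpha\beta$, $z=\alpha\beta^2$; the trivial triple, corresponding to $\alpha=0$, is $(0,0,0)$. In a triple such as $(\pm r,s,\pm t)$ the two signs are the same, so it stands for the two triples $(r,s,t)$ and $(-r,s,-t)$.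
   Formalization: It is assumed that a ≠ 0 (for a = 0 the triple (1,0,0) is a solution not on the right) and d ≠ 0 (so γ_u is defined); (0,0,0) is removed from both right-hand sides, as it appears there when γ_u = 0, e.g. (a,b,c,d) = (1,−2,1,1), u = 1. *)

(* Defs.v *)
(* Mathematical Components, with the classical sets of MathComp-Analysis. *)
From mathcomp Require Import all_boot all_order all_algebra.
From mathcomp Require Import classical_sets.

Set Implicit Arguments.
Unset Strict Implicit.
Unset Printing Implicit Defensive.

Import Order.TTheory GRing.Theory Num.Theory.
Local Open Scope classical_set_scope.
Local Open Scope ring_scope.

Definition geometric_progression (t : int * int * int) : Prop :=
  exists alpha beta : int, t = (alpha, alpha * beta, alpha * beta ^+ 2).

Definition trivial_triple : int * int * int := (0, 0, 0).

Definition GP (a b c d : int) : set (int * int * int) :=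
  [set t | [/\ geometric_progression t, t <> trivial_triple &
    let: (x, y, z) := t in
    a * x ^+ 2 + b * y ^+ 2 + c * z ^+ 2 = d * x * y * z]].

(* A genuine fraction: it need not be an integer, and the divisibility
   conditions are stated separately wherever it is used. *)
Definition gamma (a b c d u : int) : rat :=
  (c * u ^+ 4 + b * u ^+ 2 + a)%:~R / (d * u ^+ 3)%:~R.

(* The integer triples (r, s, t) and (-r, s, -t): the two signs are linked. *)
Definition pm_triple (r s t : rat) : set (int * int * int) :=
  [set w | let: (x, y, z) := w in
    [/\ x%:~R = r, y%:~R = s & z%:~R = t] \/
    [/\ x%:~R = - r, y%:~R = s & z%:~R = - t]].

Definition param_triples (a b c d : int) : set (int * int * int) :=
  [set w | exists u : int,
    [/\ (u ^+ 2 %| a)%Z, 0 < u,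
        (d * u ^+ 3 %| c * u ^+ 4 + b * u ^+ 2 + a)%Z &
        pm_triple (gamma a b c d u) (u%:~R * gamma a b c d u)
                  (u%:~R ^+ 2 * gamma a b c d u) w]].

(* 0 is not squarefree, since 2 ^+ 2 divides it. *)
Definition squarefree (a : int) : Prop :=
  forall k : int, (k ^+ 2 %| a)%Z -> `|k| = 1.

(* Main.v *)
Require Import Defs.
From mathcomp Require Import all_boot all_order all_algebra.
From mathcomp Require Import classical_sets.
From mathcomp Require Import ring lra.

(** A nontrivial progression (alpha, alpha * beta, alpha * beta ^+ 2) has
    alpha <> 0, so alpha ^+ 2 can be cancelled from the equation, leaving
    c * beta ^+ 4 + b * beta ^+ 2 + a = d * beta ^+ 3 * alpha
    ([gp_equationE]).  As a <> 0, this forces beta <> 0; it also shows that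
    beta ^+ 2 divides a, and that alpha is the quotient gamma_beta.  Since
    gamma is odd in its argument, replacing beta by u = `|beta| either changes
    nothing or turns (alpha, beta) into (- alpha, - beta), which is the linked
    sign of [pm_triple].  These steps reverse, since any nontrivial
    triple of the parametrized form satisfies the reduced equation.  When a is
    squarefree, u ^+ 2 %| a with u > 0 leaves only u = 1. *)

Set Implicit Arguments.
Unset Strict Implicit.
Unset Printing Implicit Defensive.

Import Order.TTheory GRing.Theory Num.Theory.
Local Open Scope classical_set_scope.
Local Open Scope ring_scope.

Lemma gp_equationE (a b c d x u : int) : x != 0 ->
  (a * x ^+ 2 + b * (x * u) ^+ 2 + c * (x * u ^+ 2) ^+ 2
     = d * x * (x * u) * (x * u ^+ 2)) <->
  c * u ^+ 4 + b * u ^+ 2 + a = d * u ^+ 3 * x.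
Proof.
move=> x_neq0; have x2_neq0 : x ^+ 2 != 0 by rewrite expf_neq0.
split=> eq_xu; first by apply: (mulfI x2_neq0); lra.
by have := congr1 ( *%R (x ^+ 2)) eq_xu; lra.
Qed.

Lemma dvdz_sqr_of_gp_equation (a b c d x u : int) :
  c * u ^+ 4 + b * u ^+ 2 + a = d * u ^+ 3 * x -> (u ^+ 2 %| a)%Z.
Proof.
move=> eq_xu; apply/dvdzP; exists (d * u * x - c * u ^+ 2 - b).
by lra.
Qed.

(** The sign is encoded by an integer e with e ^+ 2 = 1 that multiplies both
    the first term and the ratio of the progression. *)
Lemma pm_triple_progressionP (q u : int) (w : int * int * int) :
  pm_triple q%:~R (u%:~R * q%:~R) (u%:~R ^+ 2 * q%:~R) w <->
  exists2 e : int, (e = 1 \/ e = - 1) &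
    w = (e * q, (e * q) * (e * u), (e * q) * (e * u) ^+ 2).
Proof.
case: w => [[x y] z]; rewrite /pm_triple /= -rmorphXn -!rmorphM -!rmorphN.
split=> [[]|[e [] -> [-> -> ->]]].
- case=> /intr_inj -> /intr_inj -> /intr_inj ->.
  by exists 1; [left | congr (_, _, _); ring].
- case=> /intr_inj -> /intr_inj -> /intr_inj ->.
  by exists (- 1); [right | congr (_, _, _); ring].
- by left; split; congr (_%:~R); ring.
- by right; split; congr (_%:~R); ring.
Qed.

Lemma gamma_int (a b c d u q : int) : d != 0 -> u != 0 ->
  c * u ^+ 4 + b * u ^+ 2 + a = d * u ^+ 3 * q -> gamma a b c d u = q%:~R.
Proof.
move=> d_neq0 u_neq0 eq_qu; rewrite /gamma eq_qu [X in X / _]rmorphM mulrC mulKf //.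
by rewrite intr_eq0 mulf_neq0 ?expf_neq0.
Qed.

Lemma GP_param (a b c d : int) : a != 0 -> d != 0 ->
  GP a b c d = param_triples a b c d `\ trivial_triple.
Proof.
move=> a_neq0 d_neq0; apply/seteqP; split=> w.
- case=> [[x [v ->]] w_neq0 /= eqw]; split=> //.
  have x_neq0 : x != 0.
    by apply/eqP=> x0; apply: w_neq0; rewrite x0 !mul0r.
  move/(gp_equationE _ _ _ _ _ x_neq0): eqw => eqv.
  have v_neq0 : v != 0.
    apply: contra_neq a_neq0 => v0; move: eqv.
    by rewrite v0 !expr0n /= !mulr0 mul0r !add0r.
  (* e is the sign of v, so that e * v = `|v| is the parameter u. *)
  have [e e_sign u_gt0] : exists2 e : int, e = 1 \/ e = - 1 & 0 < e * v.
    case: (ltrP 0 v) => [v_gt0|v_le0].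
      by exists 1; [left | rewrite mul1r].
    exists (- 1); [by right | by rewrite mulN1r oppr_gt0 lt_neqAle v_neq0].
  have equ : c * (e * v) ^+ 4 + b * (e * v) ^+ 2 + a
      = d * (e * v) ^+ 3 * (e * x) by case: e_sign => ->; move: eqv; lra.
  exists (e * v); split=> //.
  + exact: dvdz_sqr_of_gp_equation equ.
  + by rewrite equ dvdz_mulr.
  + rewrite (gamma_int d_neq0 (lt0r_neq0 u_gt0) equ).
    apply/pm_triple_progressionP; exists e => //.
    by case: e_sign => ->; congr (_, _, _); ring.
- case=> [[u [_ u_gt0 /dvdzP [q]]]]; rewrite [RHS]mulrC => equ pm_w w_neq0.
  have u_neq0 := lt0r_neq0 u_gt0.
  move: pm_w; rewrite (gamma_int d_neq0 u_neq0 equ).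
  case/pm_triple_progressionP => e e_sign def_w; rewrite def_w in w_neq0 *.
  split=> //; first by exists (e * q), (e * u).
  have eq_neq0 : e * q != 0.
    by apply/eqP=> eq0; apply: w_neq0; rewrite eq0 !mul0r.
  by apply/(gp_equationE _ _ _ _ _ eq_neq0); case: e_sign => ->; move: equ; lra.
Qed.

Lemma param_triples_squarefree (a b c d : int) : squarefree a ->
  let g : rat := (a + b + c)%:~R / d%:~R in
  param_triples a b c d =
    if (d %| a + b + c)%Z then pm_triple g g g else set0.
Proof.
move=> sqf_a g.
have num1 : c * 1 ^+ 4 + b * 1 ^+ 2 + a = a + b + c by ring.
have den1 : d * 1 ^+ 3 = d by ring.
have gamma1 : gamma a b c d 1 = g by rewrite /gamma num1 den1.
apply/seteqP; split=> w.
- case=> u [/sqf_a u_norm1 u_gt0].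
  have -> : u = 1 by rewrite -u_norm1 gtr0_norm.
  by rewrite num1 den1 gamma1 expr1n !mul1r => ->.
- case: ifP => // d_dvd pm_w; exists 1; split=> //.
  + by rewrite num1 den1.
  + by rewrite gamma1 expr1n !mul1r.
Qed.

(* d <> 0 is needed for gamma to be defined.  If a = 0, then every (x, 0, 0)
   with x <> 0 lies in GP and in none of the right-hand sides.  If gamma
   vanishes (as for (a, b, c, d) = (1, -2, 1, 1) and u = 1), the right-hand
   sides produce the trivial triple, which GP excludes by definition, so they
   too are read as sets of nontrivial triples. *)
Theorem theorem4p3 (a b c d : int) (a_neq0 : a <> 0) (d_neq0 : d <> 0) :
  GP a b c d = param_triples a b c d `\ trivial_triple /\
  (squarefree a ->
   forall g : rat, g = (a + b + c)%:~R / d%:~R ->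
   GP a b c d =
     (if (d %| a + b + c)%Z then pm_triple g g g else set0)
       `\ trivial_triple).
Proof.
move/eqP: a_neq0 => a_neq0; move/eqP: d_neq0 => d_neq0.
split=> [|sqf_a g ->]; first exact: GP_param.
by rewrite GP_param // param_triples_squarefree.
Qed.
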